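(* Let $t\ge1$ be an integer. For any $\mathbf{x},\mathbf{y}\in\mathrm{St}(d,r)^N$, $$\langle\mathrm{grad}\,\varphi^t(\mathbf{x}),\mathbf{y}-\mathbf{x}\rangle=\langle\nabla\varphi^t(\mathbf{x}),\mathbf{y}-\mathbf{x}\rangle+\frac14\sum_{i=1}^N\Big\langle\sum_{j=1}^NW^t_{ij}(x_i-x_j)^\top(x_i-x_j),\,(y_i-x_i)^\top(y_i-x_i)\Big\rangle\ \ge\ \langle\nabla\varphi^t(\mathbf{x}),\mathbf{y}-\mathbf{x}\rangle.$$
   Context: Let $1\le r\le d$ and $N\ge2$ be integers and $\mathrm{St}(d,r)=\{x\in\mathbb{R}^{d\times r}:x^\top x=I_r\}$. Inner products are $\langle x,y\rangle=\mathrm{Tr}(x^\top y)$ and $\|\cdot\|_F$ is the Frobenius norm, applied also to stacked tuples $\mathbf{x}=(x_1,\dots,x_N)$. $W\in\mathbb{R}^{N\times N}$ is the communication matrix of a connected undirected graph on $N$ nodes; it is symmetric and doubly stochastic, $W_{ij}\ge0$, $0<W_{ii}<1$, its eigenvalues lie in $(-1,1]$, and its second largest singular value lies in $[0,1)$. $W^t_{ij}$ is the $(i,j)$ entry of the $t$-th power $W^t$. $\varphi^t(\mathbf{x})=\frac14\sum_{i,j=1}^N W^t_{ij}\|x_i-x_j\|_F^2$. The Euclidean gradient $\nabla\varphi^t(\mathbf{x})$ has blocks $\nabla\varphi^t_i(\mathbf{x})=x_i-\sum_{j}W^t_{ij}x_j$, and the Riemannian gradient $\mathrm{grad}\,\varphi^t(\mathbf{x})$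 on $\mathrm{St}(d,r)^N$ has blocks $\mathrm{grad}\,\varphi^t_i(\mathbf{x})=\mathcal{P}_{T_{x_i}}(\nabla\varphi^t_i(\mathbf{x}))$ with $\mathcal{P}_{T_x}(y)=y-\frac12x(x^\top y+y^\top x)$. *)

(* Defs.v *)
From HB Require Import structures.
From mathcomp Require Import all_boot all_order all_algebra.
From mathcomp Require Import boolp reals topology normedtype derive.
From mathcomp Require Import ring lra.

Set Implicit Arguments.
Unset Strict Implicit.
Unset Printing Implicit Defensive.

Import Order.TTheory GRing.Theory Num.Theory.
Import numFieldNormedType.Exports.

Local Open Scope ring_scope.

Section Stiefel.
Variables (R : realType) (d r : nat).
Implicit Types x y : 'M[R]_(d, r).

Definition in_stiefel x : Prop := x^T *m x = 1%:M.

Definition tangent x y : Prop := x^T *m y + y^T *m x = 0.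

Definition proj_tangent x y : 'M[R]_(d, r) :=
  y - 2^-1 *: (x *m (x^T *m y + y^T *m x)).

End Stiefel.

Section Frobenius.
Variables (R : realType) (m n : nat).
Implicit Types x y : 'M[R]_(m, n).

Definition frob_inner x y : R := \tr (x^T *m y).

Definition frob_norm x : R := Num.sqrt (frob_inner x x).

Definition stack_inner (N : nat) (x y : {ffun 'I_N -> 'M[R]_(m, n)}) : R :=
  \sum_(i < N) frob_inner (x i) (y i).

End Frobenius.

(* [s] lists the singular values of the square matrix [A] in nonincreasing
   order and with multiplicity: the nonnegative square roots of the eigenvalues
   of A^T A, an eigenvalue being repeated as a root of the characteristic
   polynomial. *)
Definition singular_values (R : realType) (n : nat) (A : 'M[R]_n) (s : seq R) :
    Prop :=
  [/\ all (fun a => 0 <= a) s, sorted (fun a b => b <= a) s &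
      char_poly (A^T *m A) = \prod_(a <- s) ('X - (a ^+ 2)%:P)].

Definition undirected_connected_graph (N : nat) (e : rel 'I_N) : Prop :=
  [/\ symmetric e, irreflexive e & forall i j, connect e i j].

Record communication_matrix (R : realType) (N : nat) (e : rel 'I_N)
    (W : 'M[R]_N) : Prop := CommunicationMatrix {
  comm_graph : undirected_connected_graph e;
  comm_edge : forall i j, i != j -> (0 < W i j) = e i j;
  comm_sym : W^T = W;
  comm_ge0 : forall i j, 0 <= W i j;
  comm_row : forall i, \sum_(j < N) W i j = 1;
  comm_col : forall j, \sum_(i < N) W i j = 1;
  comm_diag : forall i, 0 < W i i < 1;
  (* [W] is symmetric, so its eigenvalues in [R] are all of its eigenvalues. *)
  comm_eigen : forall a : R, eigenvalue W a -> -1 < a <= 1;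
  comm_singular : exists2 s, singular_values W s & 0 <= s`_1 < 1
}.

Section Consensus.
Variables (R : realType) (N d r : nat).
Implicit Types (W : 'M[R]_N) (t : nat) (x : {ffun 'I_N -> 'M[R]_(d, r)}).

Definition consensus W t x : R :=
  4^-1 * \sum_(i < N) \sum_(j < N)
           (W ^+ t) i j * frob_norm (x i - x j) ^+ 2.

Definition unit_dir (i : 'I_N) (a : 'I_d) (b : 'I_r) :
    {ffun 'I_N -> 'M[R]_(d, r)} :=
  [ffun k => if k == i then delta_mx a b else 0].

(* [derive1] is total; on [consensus] it takes the expected value, see
   [consensus_gradientE]. *)
Definition euclidean_gradient (f : {ffun 'I_N -> 'M[R]_(d, r)} -> R) x :
    {ffun 'I_N -> 'M[R]_(d, r)} :=
  [ffun i => \matrix_(a, b)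
     derive1 (fun s : R => f (x + s *: unit_dir i a b)) 0].

(* For the metric induced from the ambient space, at a point of the product of
   Stiefel manifolds; see [proj_tangentP]. *)
Definition riemannian_gradient (f : {ffun 'I_N -> 'M[R]_(d, r)} -> R) x :
    {ffun 'I_N -> 'M[R]_(d, r)} :=
  [ffun i => proj_tangent (x i) (euclidean_gradient f x i)].

End Consensus.

Section FrobeniusTheory.
Variables (R : realType) (m n : nat).
Implicit Types x y z : 'M[R]_(m, n).

Lemma frob_innerE x y : frob_inner x y = \sum_i \sum_j x i j * y i j.
Proof.
rewrite /frob_inner /mxtrace exchange_big /=.
by apply: eq_bigr => j _; rewrite mxE; apply: eq_bigr => i _; rewrite mxE.
Qed.

Lemma frob_innerC x y : frob_inner x y = frob_inner y x.
Proof.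
rewrite !frob_innerE; apply: eq_bigr => i _; apply: eq_bigr => j _.
exact: mulrC.
Qed.

Lemma frob_innerDr x y z : frob_inner x (y + z) = frob_inner x y + frob_inner x z.
Proof. by rewrite /frob_inner mulmxDr linearD. Qed.

Lemma frob_innerZr a x y : frob_inner x (a *: y) = a * frob_inner x y.
Proof. by rewrite /frob_inner -scalemxAr linearZ. Qed.

Lemma frob_innerBr x y z : frob_inner x (y - z) = frob_inner x y - frob_inner x z.
Proof. by rewrite -scaleN1r frob_innerDr frob_innerZr mulN1r. Qed.

Lemma frob_innerDl x y z : frob_inner (x + y) z = frob_inner x z + frob_inner y z.
Proof. by rewrite !(frob_innerC _ z) frob_innerDr. Qed.

Lemma frob_innerZl a x y : frob_inner (a *: x) y = a * frob_inner x y.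
Proof. by rewrite !(frob_innerC _ y) frob_innerZr. Qed.

Lemma frob_inner_suml (I : finType) (F : I -> 'M[R]_(m, n)) y :
  frob_inner (\sum_i F i) y = \sum_i frob_inner (F i) y.
Proof. by rewrite /frob_inner raddf_sum /= mulmx_suml raddf_sum. Qed.

Lemma frob_inner_delta x a b : frob_inner x (delta_mx a b) = x a b.
Proof.
rewrite frob_innerE (bigD1 a) //= (bigD1 b) //= mxE !eqxx mulr1.
rewrite big1 => [|j /negPf nj]; last by rewrite mxE nj andbF mulr0.
rewrite big1 ?addr0 // => i /negPf ni; rewrite big1 // => j _.
by rewrite mxE ni mulr0.
Qed.

Lemma frob_inner_ge0 x : 0 <= frob_inner x x.
Proof.
rewrite frob_innerE; apply: sumr_ge0 => i _; apply: sumr_ge0 => j _.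
by rewrite -expr2 sqr_ge0.
Qed.

Lemma frob_norm_sqr x : frob_norm x ^+ 2 = frob_inner x x.
Proof. by rewrite sqr_sqrtr ?frob_inner_ge0. Qed.

(* [proj_tangent x] is the orthogonal projection onto [tangent x]. *)
Lemma proj_tangentP x y : in_stiefel x ->
  tangent x (proj_tangent x y) /\
  (forall z, tangent x z -> frob_inner (y - proj_tangent x y) z = 0).
Proof.
rewrite /in_stiefel /tangent /proj_tangent => xx.
set S := x^T *m y + y^T *m x.
have ST : S^T = S.
  by rewrite /S linearD /= !trmx_mul !trmxK addrC.
split=> [|z xz].
  rewrite mulmxBr linearB /= mulmxBl -scalemxAr (linearZ _ (x *m S)) /=.
  rewrite -scalemxAl trmx_mul ST mulmxA xx mul1mx -mulmxA xx mulmx1.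
  rewrite addrACA -opprD -scalerDl.
  have -> : 2^-1 + 2^-1 = 1 :> R by lra.
  by rewrite scale1r subrr.
rewrite opprB addrC subrK frob_innerZl /frob_inner trmx_mul ST -mulmxA.
suff -> : \tr (S *m (x^T *m z)) = 0 by rewrite mulr0.
have e1 : \tr (S *m (x^T *m z)) = \tr (S *m (z^T *m x)).
  by rewrite -mxtrace_tr !trmx_mul trmxK ST mxtrace_mulC.
have : \tr (S *m (x^T *m z)) + \tr (S *m (z^T *m x)) = 0.
  by rewrite -linearD /= -mulmxDr xz mulmx0 linear0.
by rewrite -e1; lra.
Qed.

End FrobeniusTheory.

Section ConsensusTheory.
Variables (R : realType) (N d r : nat) (e : rel 'I_N) (W : 'M[R]_N).
Hypothesis hW : communication_matrix e W.

Lemma comm_exp_sym t i j : (W ^+ t) i j = (W ^+ t) j i.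
Proof.
suff h : (W ^+ t)^T = W ^+ t by rewrite -[in LHS]h mxE.
elim: t => [|t IH]; first by rewrite expr0 trmx1.
by rewrite {1}exprS -[_ * _]/(_ *m _) trmx_mul IH (comm_sym hW) [RHS]exprSr.
Qed.

Lemma comm_exp_row t i : \sum_j (W ^+ t) i j = 1.
Proof.
elim: t i => [|t IH] i.
  rewrite expr0 (bigD1 i) //= mxE eqxx big1 ?addr0 // => j ne.
  by rewrite mxE eq_sym (negPf ne).
rewrite exprS -[_ * _]/(_ *m _).
under eq_bigr do rewrite mxE.
rewrite exchange_big /= -(comm_row hW i); apply: eq_bigr => k _.
by rewrite -mulr_sumr IH mulr1.
Qed.

Lemma derive1_quadratic (a b c : R) :
  derive1 (fun s : R => a + b * s + c * s ^+ 2) 0 = b.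
Proof.
pose p : {poly R} := a%:P + b *: 'X + c *: 'X^2.
rewrite (_ : (fun s => _) = horner p); last first.
  by apply: funext => s; rewrite /p !hornerE.
rewrite derive1E (derive_val (is_derive := is_derive_poly p 0)) /p.
rewrite derivD derivD derivC !derivZ derivX derivXn.
by rewrite !hornerE.
Qed.

Lemma consensus_gradientE t (x : {ffun 'I_N -> 'M[R]_(d, r)}) i :
  euclidean_gradient (consensus W t) x i
  = x i - \sum_(j < N) (W ^+ t) i j *: x j.
Proof.
set w := W ^+ t.
apply/matrixP => a b; rewrite ffunE mxE.
pose Q (y z : {ffun 'I_N -> 'M[R]_(d, r)}) :=
  \sum_k \sum_l w k l * frob_inner (y k - y l) (z k - z l).
have QE v s : consensus W t (x + s *: v)
    = 4^-1 * Q x x + (2^-1 * Q x v) * s + (4^-1 * Q v v) * s ^+ 2.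
  have -> : 4^-1 * Q x x + (2^-1 * Q x v) * s + (4^-1 * Q v v) * s ^+ 2
     = 4^-1 * (Q x x + (2 * s) * Q x v + s ^+ 2 * Q v v) by field.
  congr (_ * _); rewrite /Q !mulr_sumr -!big_split; apply: eq_bigr => k _ /=.
  rewrite !mulr_sumr -!big_split; apply: eq_bigr => l _ /=.
  rewrite frob_norm_sqr !ffunE opprD addrACA -scalerBr.
  move: (x k - x l) (v k - v l) => u u'.
  rewrite !(frob_innerDl, frob_innerDr, frob_innerZl, frob_innerZr).
  by rewrite (frob_innerC u' u) /w; ring.
set v := unit_dir R i a b.
rewrite (_ : (fun s => _) = fun s =>
    4^-1 * Q x x + (2^-1 * Q x v) * s + (4^-1 * Q v v) * s ^+ 2);
  last by apply: funext => s; exact: QE.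
rewrite derive1_quadratic.
have -> : Q x v = 2 * \sum_k \sum_l w k l * frob_inner (x k - x l) (v k).
  rewrite /Q mulr_natl mulr2n [X in _ = _ + X]exchange_big -big_split.
  apply: eq_bigr => k _; rewrite -big_split; apply: eq_bigr => l _ /=.
  rewrite frob_innerBr /w (comm_exp_sym t l k) -[x l - x k]opprB.
  rewrite -[- (x k - x l)]scaleN1r.
  by rewrite frob_innerZl; ring.
rewrite mulrA mulVf ?mul1r ?pnatr_eq0 // (bigD1 i) //= [X in _ + X]big1 ?addr0.
  under eq_bigr do rewrite ffunE eqxx frob_inner_delta !mxE mulrBr.
  rewrite sumrB -mulr_suml comm_exp_row mul1r !mxE summxE.
  by congr (_ - _); apply: eq_bigr => l _; rewrite mxE.
move=> k /negPf nk; rewrite big1 // => l _.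
by rewrite ffunE nk /frob_inner mulmx0 linear0 mulr0.
Qed.

End ConsensusTheory.

(* Main.v *)
(* At a point [x] of the Stiefel manifold, projecting a vector [g] subtracts
   half of [x *m S] with [S = x^T g + g^T x].  On the manifold
   [x^T y + y^T x = 2 - (y - x)^T (y - x)], and this identity is used twice:
   to turn the inner product of [x *m S] with [y - x] into one of [S] with
   [(y - x)^T (y - x)], and, as the rows of [W ^+ t] sum to 1, to write [S] for
   the consensus gradient as the weighted sum of the [(x_i - x_j)^T (x_i - x_j)].
   Gram matrices have nonnegative inner products, whence the inequality. *)
Require Import Defs.
From mathcomp Require Import all_boot all_order all_algebra.
From mathcomp Require Import boolp reals topology normedtype derive.
From mathcomp Require Import ring.
Import Order.TTheory GRing.Theory Num.Theory.
Local Open Scope ring_scope.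

Lemma stiefel_gram_sub (R : realType) (d r : nat) (x y : 'M[R]_(d, r)) :
  in_stiefel x -> in_stiefel y ->
  (x - y)^T *m (x - y) = 2%:M - (x^T *m y + y^T *m x).
Proof.
rewrite /in_stiefel => xx yy.
rewrite [(x - y)^T]linearB /= mulmxBl !mulmxBr xx yy.
(* The two products stay opaque: entry by entry the identity is linear in them. *)
by apply/matrixP => i j; move: (x^T *m y) (y^T *m x) => a b; rewrite !mxE; ring.
Qed.

(** By cyclicity of the trace, this inner product is the squared Frobenius norm of [a *m b^T]. *)
Lemma frob_inner_gram_ge0 (R : realType) (m n p : nat)
    (a : 'M[R]_(m, n)) (b : 'M[R]_(p, n)) :
  0 <= frob_inner (a^T *m a) (b^T *m b).
Proof.
have -> : frob_inner (a^T *m a) (b^T *m b) = frob_inner (a *m b^T) (a *m b^T).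
  rewrite /frob_inner !trmx_mul !trmxK -!mulmxA.
  by rewrite [RHS]mxtrace_mulC -!mulmxA.
exact: frob_inner_ge0.
Qed.

Lemma frob_inner_proj_tangent (R : realType) (d r : nat) (x y g : 'M[R]_(d, r)) :
  in_stiefel x -> in_stiefel y ->
  frob_inner (proj_tangent x g) (y - x) = frob_inner g (y - x)
    + 4^-1 * frob_inner (x^T *m g + g^T *m x) ((y - x)^T *m (y - x)).
Proof.
move=> xx yy; rewrite stiefel_gram_sub // /proj_tangent.
set S := x^T *m g + g^T *m x.
have ST : S^T = S by rewrite /S linearD /= !trmx_mul !trmxK addrC.
have xSE : frob_inner (x *m S) (y - x) = frob_inner S (x^T *m y) - \tr S.
  rewrite /frob_inner trmx_mul -mulmxA mulmxBr mulmxBr ST.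
  by move: xx; rewrite /in_stiefel => ->; rewrite mulmx1 linearB.
(* A symmetric [S] pairs equally with a matrix and its transpose. Hence [S] against the Gram matrix
   of [y - x] gives [2 * \tr S - 2 * frob_inner S (x^T *m y)], which is -2 times the value in [xSE];
   the factor -1/2 of the projection thus becomes 1/4. *)
have SC : frob_inner S (y^T *m x) = frob_inner S (x^T *m y).
  by rewrite /frob_inner ST -mxtrace_tr !trmx_mul trmxK ST mxtrace_mulC.
have S2 : frob_inner S 2%:M = 2 * \tr S.
  by rewrite /frob_inner ST mul_mx_scalar linearZ.
rewrite -scaleN1r frob_innerDl !frob_innerZl xSE.
rewrite [frob_inner S (_ - _)]frob_innerBr [frob_inner S (_ + _)]frob_innerDr SC S2.
by field.
Qed.

Lemma comm_exp_ge0 {R : realType} {N : nat} {e : rel 'I_N} {W : 'M[R]_N}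
    (hW : communication_matrix e W) (t : nat) (i j : 'I_N) :
  0 <= (W ^+ t) i j.
Proof.
elim: t i j => [|t IH] i j; first by rewrite expr0 mxE; case: eqP.
rewrite exprS mxE; apply: sumr_ge0 => k _.
by rewrite mulr_ge0 // (comm_ge0 hW).
Qed.

Lemma consensus_gradient_normal {R : realType} {N d r : nat} {e : rel 'I_N}
    {W : 'M[R]_N} (hW : communication_matrix e W) (t : nat)
    {x : {ffun 'I_N -> 'M[R]_(d, r)}} (hx : forall i, in_stiefel (x i)) i :
  let g := euclidean_gradient (consensus W t) x i in
  (x i)^T *m g + g^T *m x i
    = \sum_j (W ^+ t) i j *: ((x i - x j)^T *m (x i - x j)).
Proof.
move=> /=; rewrite (consensus_gradientE hW).
have -> : x i - \sum_j (W ^+ t) i j *: x j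
    = \sum_j (W ^+ t) i j *: (x i - x j).
  under [RHS]eq_bigr do rewrite scalerBr.
  by rewrite sumrB -scaler_suml (comm_exp_row hW) scale1r.
rewrite mulmx_sumr linear_sum /= mulmx_suml -big_split /=.
apply: eq_bigr => j _.
rewrite -scalemxAr [(_ *: _)^T]linearZ /= -scalemxAl -scalerDr; congr (_ *: _).
(* Both sides equal [2%:M] minus the symmetrized product of [x i] and [x j]; on the left the 2 is
   the sum of two copies of [(x i)^T *m x i]. *)
rewrite stiefel_gram_sub // [(x i - _)^T]linearB /= mulmxBr mulmxBl !(hx i).
by rewrite addrACA -opprD -raddfD.
Qed.

Theorem lemma3 (R : realType) (N d r : nat)
  (hN : (2 <= N)%N) (hr : (1 <= r <= d)%N)
  (e : rel 'I_N) (W : 'M[R]_N) (hW : communication_matrix e W)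
  (t : nat) (ht : (1 <= t)%N)
  (x y : {ffun 'I_N -> 'M[R]_(d, r)})
  (hx : forall i, in_stiefel (x i)) (hy : forall i, in_stiefel (y i)) :
  stack_inner (riemannian_gradient (consensus W t) x) (y - x)
    = stack_inner (euclidean_gradient (consensus W t) x) (y - x)
      + 4^-1 * \sum_(i < N)
          frob_inner
            (\sum_(j < N) (W ^+ t) i j *: ((x i - x j)^T *m (x i - x j)))
            ((y i - x i)^T *m (y i - x i))
  /\ stack_inner (riemannian_gradient (consensus W t) x) (y - x)
     >= stack_inner (euclidean_gradient (consensus W t) x) (y - x).
Proof.
set G := stack_inner (riemannian_gradient _ _) _.
set E := stack_inner _ _; set D := 4^-1 * _.
have GE : G = E + D.
  rewrite /G /E /D /stack_inner mulr_sumr -big_split; apply: eq_bigr => i _ /=.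
  have -> : (y - x) i = y i - x i by rewrite !ffunE.
  rewrite [riemannian_gradient _ _ i]ffunE frob_inner_proj_tangent //.
  by rewrite (consensus_gradient_normal hW t hx).
split=> //; rewrite GE lerDl mulr_ge0 ?invr_ge0 //.
(* Linearity splits [D] into nonnegative weights times inner products of Gram matrices. *)
apply: sumr_ge0 => i _; rewrite frob_inner_suml; apply: sumr_ge0 => j _.
by rewrite frob_innerZl mulr_ge0 ?(comm_exp_ge0 hW) ?frob_inner_gram_ge0.
Qed.
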